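(* Let $k\ge 2$, $i=1$, $r,s\ge 1$ and $n\ge 0$ be integers. Then $$\det\left(A_kQ_k^{\,n+1}\right)=s^{n+k}(-1)^{\frac{(k-1)(k+6)+2(k+1)(n+1)}{2}}.$$
   Context: For integers $i,k,r,s\ge 1$, the sequence $F^{i}_{r,s}(k,n)$, $n\ge -1$, is defined as follows. If $i\le k$, then $F^{i}_{r,s}(k,n)=r^{\lfloor (n+1)/i\rfloor}$ for $n=-1,0,\ldots,k-2$; if $k<i$, then $F^{i}_{r,s}(k,n)=s^{\lfloor (n+1)/k\rfloor}$ for $n=-1,0,\ldots,i-2$; and for all $n\ge \max\{k,i\}-1$, $F^{i}_{r,s}(k,n)=rF^{i}_{r,s}(k,n-i)+sF^{i}_{r,s}(k,n-k)$. For $k\ge i$, $Q_k=[q_{tj}]$ is the $k\times k$ matrix in which, for $1\le t\le k$, $q_{t1}$ is the coefficient of $F^{i}_{r,s}(k,n-t)$ in the recurrence $F^{i}_{r,s}(k,n)=rF^{i}_{r,s}(k,n-i)+sF^{i}_{r,s}(k,n-k)$ (so for $i=1<k$: $q_{11}=r$, $q_{k1}=s$ and $q_{t1}=0$ otherwise), and for $j\ge 2$, $q_{tj}=1$ if $j=t+1$ and $q_{tj}=0$ otherwise. $A_k$ is the $k\times k$ matrix whose $(a,b)$ entry, $1\le a,b\le k$, is $F^{i}_{r,s}(k,2k-1-a-b)$ (so its top-left entry is $F^{i}_{r,s}(k,2k-3)$ and its bottom-right entry is $F^{i}_{r,s}(k,-1)$). *)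

(* Defs.v *)
From HB Require Import structures.
From mathcomp Require Import all_boot all_order all_algebra.
From mathcomp Require Import zify.

Set Implicit Arguments.
Unset Strict Implicit.
Unset Printing Implicit Defensive.

Import Order.TTheory GRing.Theory Num.Theory.
Local Open Scope ring_scope.

(* Value F^i_{r,s}(k, m - 1), i.e. the sequence reindexed to start at 0.
   The first argument is recursion fuel: each recursive call decreases m when
   i, k >= 1, so any fuel > m gives the same value. *)
Fixpoint Frec (fuel i : nat) (r s : int) (k m : nat) : int :=
  if fuel is fuel'.+1 then
    if (m < maxn k i)%N then
      if (i <= k)%N then r ^+ (m %/ i) else s ^+ (m %/ k)
    else r * Frec fuel' i r s k (m - i) + s * Frec fuel' i r s k (m - k)
  else 0.

(* F^i_{r,s}(k, n), meaningful for n >= -1; the value is 0 for n < -1. *)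
Definition Fseq (i : nat) (r s : int) (k : nat) (n : int) : int :=
  if n + 1 is Posz m then Frec m.+1 i r s k m else 0.

Lemma Frec_fuel (i : nat) (r s : int) (k f g m : nat) :
  (1 <= i)%N -> (1 <= k)%N -> (m < f)%N -> (m < g)%N ->
  Frec f i r s k m = Frec g i r s k m.
Proof.
move=> i1 k1; elim: f g m => [|f IH] [|g] m //= mf mg.
case: ifP => // Hm; congr (_ * _ + _ * _); apply: IH; lia.
Qed.

Lemma Fseq_init_le (i : nat) (r s : int) (k m : nat) :
  (i <= k)%N -> (m < k)%N -> Fseq i r s k (m%:Z - 1) = r ^+ (m %/ i).
Proof. by move=> ik mk; rewrite /Fseq subrK /= leq_max mk ik. Qed.

Lemma Fseq_init_gt (i : nat) (r s : int) (k m : nat) :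
  (k < i)%N -> (m < i)%N -> Fseq i r s k (m%:Z - 1) = s ^+ (m %/ k).
Proof. by move=> ki mi; rewrite /Fseq subrK /= leq_max mi orbT leqNgt ki. Qed.

Lemma Fseq_rec (i : nat) (r s : int) (k : nat) (n : int) :
  (1 <= i)%N -> (1 <= k)%N -> (maxn k i)%:Z - 1 <= n ->
  Fseq i r s k n = r * Fseq i r s k (n - i%:Z) + s * Fseq i r s k (n - k%:Z).
Proof.
move=> i1 k1 Hn.
have [m Em] : exists m : nat, n = m%:Z - 1 :> int by exists (absz (n + 1)); lia.
subst n; have Hm : (maxn k i <= m)%N by lia.
have Ei : m%:Z - 1 - i%:Z + 1 = (m - i)%N%:Z by lia.
have Ek : m%:Z - 1 - k%:Z + 1 = (m - k)%N%:Z by lia.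
rewrite /Fseq subrK Ei Ek.
have -> : Frec m.+1 i r s k m =
    r * Frec m i r s k (m - i) + s * Frec m i r s k (m - k).
  by rewrite /= ltnNge Hm.
congr (_ * _ + _ * _); apply: Frec_fuel => //; lia.
Qed.

(* Matrix indices are 0-based: row t and column j below are row t.+1 and
   column j.+1 in 1-based numbering.  The coefficient of F(k, n - t) in the
   recurrence is r for t = i plus s for t = k (so r + s when i = k). *)
Definition Qmat (i : nat) (r s : int) (k : nat) : 'M[int]_k :=
  \matrix_(t < k, j < k)
    if j == 0%N :> nat then r *+ (t.+1 == i) + s *+ (t.+1 == k)
    else (j == t.+1 :> nat)%:R.

Definition Amat (i : nat) (r s : int) (k : nat) : 'M[int]_k :=
  \matrix_(a < k, b < k) Fseq i r s k (2 * k%:Z - 1 - a.+1%:Z - b.+1%:Z).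

(* Main.v *)
(** Since [F(n) - r F(n-1) = s F(n-k)] holds for all [n >= 0] once [F] is
    extended by [0] below [-1], subtracting from each column of [A_k] [r] times
    the next one leaves a bottom row [(0, ..., 0, 1)] and, after deleting the
    last row and column, an anti-triangular matrix whose antidiagonal entries
    are all [s]; hence [det A_k = (-1)^((k-1)(k-2)/2) s^(k-1)].  Expanding
    [Q_k] along its last row gives [det Q_k = (-1)^(k-1) s]. *)
Require Import Defs.
From HB Require Import structures.
From mathcomp Require Import all_boot all_order all_algebra.
From mathcomp Require Import zify.

Set Implicit Arguments.
Unset Strict Implicit.
Unset Printing Implicit Defensive.

Import Order.TTheory GRing.Theory Num.Theory.
Local Open Scope ring_scope.

Lemma det_exp (R : comPzRingType) (k : nat) (M : 'M[R]_k) (n : nat) :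
  \det (M ^+ n) = \det M ^+ n.
Proof.
elim: n => [|n IH]; first by rewrite !expr0 det1.
by rewrite !exprS -IH -det_mulmx.
Qed.

(** Induction by expansion along the last row: only its first entry [c] survives, with sign
    [(-1) ^+ (n - 1)], and the minor is again anti-triangular. The sign exponents add up to
    ['C(n, 2)]. *)
Lemma det_antitrig (R : comPzRingType) (n : nat) (c : R) (M : 'M[R]_n) :
  (forall a b : 'I_n, (n <= a + b)%N -> M a b = 0) ->
  (forall a b : 'I_n, (a + b).+1 = n -> M a b = c) ->
  \det M = (-1) ^+ 'C(n, 2) * c ^+ n.
Proof.
elim: n M => [|n IH] M M0 Mc; first by rewrite det_mx00 expr0 mulr1.
rewrite (expand_det_row _ ord_max) (bigD1 ord0) //= big1 ?addr0; last first.
  by move=> j; rewrite -val_eqE /= => j0; rewrite M0 ?mul0r //=; lia.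
rewrite Mc /= ?addn0 // /cofactor addn0 IH.
- by rewrite binS bin1 exprD exprS [RHS]mulrCA [_ * (-1) ^+ n]mulrC -mulrA.
- by move=> a b ab; rewrite !mxE M0 //= /bump /=; have := ltn_ord a; lia.
- by move=> a b ab; rewrite !mxE Mc //= /bump /=; have := ltn_ord a; lia.
Qed.

Lemma Fseq_lt (i : nat) (r s : int) (k : nat) (n : int) :
  n < -1 -> Fseq i r s k n = 0.
Proof. by move=> n1; rewrite /Fseq; case E: (n + 1) => [m|m] //; lia. Qed.

(** Below [k - 1] both sides vanish: the initial values are powers of [r], hence geometric with
    ratio [r], and [n - k] falls below [-1]. *)
Lemma Fseq1_rec (r s : int) (k : nat) (n : int) : (1 <= k)%N -> 0 <= n ->
  Fseq 1 r s k n - r * Fseq 1 r s k (n - 1) = s * Fseq 1 r s k (n - k%:Z).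
Proof.
move=> k1 n0; have [nk|nk] := ltP n (k%:Z - 1); last first.
  by rewrite Fseq_rec ?(maxn_idPl _) // addrAC subrr add0r.
case: n n0 nk => // m _ nk.
rewrite [X in _ = _ * X]Fseq_lt ?mulr0; last by lia.
have -> : Posz m = m.+1%:Z - 1 by lia.
rewrite Fseq_init_le ?divn1; [|lia..].
have -> : m.+1%:Z - 1 - 1 = m%:Z - 1 by lia.
by rewrite Fseq_init_le ?divn1 ?exprS ?subrr; lia.
Qed.

Lemma det_Qmat1 (r s : int) (p : nat) :
  (1 <= p)%N -> \det (Qmat 1 r s p.+1) = (-1) ^+ p * s.
Proof.
move=> p1; rewrite (expand_det_row _ ord_max) (bigD1 ord0) //= big1 ?addr0.
  (* Since [1 <= p], the coefficient [r] sits in another row, so the corner entry is [s] alone; its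
     minor is the identity. *)
  rewrite mxE /= eqxx eqSS (gtn_eqF p1) mulr0n add0r mulr1n /cofactor addn0.
  rewrite (_ : row' _ _ = 1%:M) ?det1 ?mulr1 ?[s * _]mulrC //.
  by apply/matrixP=> t j; rewrite !mxE lift0 lift_max eqSS [in RHS]eq_sym.
move=> j; rewrite mxE -val_eqE /= => /negbTE ->.
by rewrite (ltn_eqF (ltn_ord j)) mul0r.
Qed.

Lemma det_Amat1 (r s : int) (p : nat) :
  \det (Amat 1 r s p.+1) = (-1) ^+ 'C(p, 2) * s ^+ p.
Proof.
pose A := Amat 1 r s p.+1.
pose L : 'M[int]_p.+1 := \matrix_(i, j) ((i == j)%:R - r *+ (i == j.+1 :> nat)).
have detL : \det L = 1.
  rewrite det_trig; last first.
    apply/is_trig_mxP => i j ij; rewrite mxE -val_eqE (ltn_eqF ij).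
    by rewrite (ltn_eqF (ltnW _)) ?subrr.
  by apply: big1 => i _; rewrite mxE eqxx (ltn_eqF (ltnSn _)) subr0.
(* Keeping [b] a plain number lets this serve both the full matrix and its minor, whose column
   indices have different types. *)
have AL a b (bp : (b < p)%N) (j : 'I_p.+1) : j = b :> nat ->
    (A *m L) a j = s * Fseq 1 r s p.+1 (p%:Z - 2 - a%:Z - b%:Z).
  move=> jb; have b1 : (b.+1 < p.+1)%N by [].
  rewrite mxE (bigD1 j) //= (bigD1 (Ordinal b1)) /=; last first.
    by rewrite -val_eqE /= jb; lia.
  rewrite big1 ?addr0; last first.
    move=> i; rewrite -!val_eqE /= jb => /andP[i1 i2].
    by rewrite !mxE -val_eqE /= jb (negbTE i1) (negbTE i2) subrr mulr0.
  rewrite !mxE -val_eqE /= jb !eqxx (ltn_eqF (ltnSn _)).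
  rewrite -val_eqE /= jb (gtn_eqF (ltnSn _)).
  rewrite subr0 mulr1 sub0r mulr1n mulrN [_ * r]mulrC.
  have -> : p%:Z - 2 - a%:Z - b%:Z =
            2 * p.+1%:Z - 1 - a.+1%:Z - b.+1%:Z - p.+1%:Z by lia.
  (* The index [2p - 1 - a - b] is nonnegative because [a <= p] and [b < p]. *)
  rewrite -Fseq1_rec //; last by have := ltn_ord a; lia.
  by congr (_ - _ * Fseq _ _ _ _ _); lia.
have ALmax : (A *m L) ord_max ord_max = 1.
  rewrite mxE (bigD1 ord_max) //= big1 ?addr0; last first.
    move=> i; rewrite !mxE => im.
    by rewrite (negbTE im) (ltn_eqF (ltn_ord i)) subrr mulr0.
  rewrite !mxE eqxx (ltn_eqF (ltnSn _)) subr0 mulr1.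
  have -> : 2 * p.+1%:Z - 1 - p.+1%:Z - p.+1%:Z = 0%N%:Z - 1 by lia.
  by rewrite Fseq_init_le.
rewrite -[LHS]mulr1 -[X in _ * X = _]detL -det_mulmx -/A (expand_det_row _ ord_max).
rewrite (bigD1 ord_max) //= big1 ?addr0; last first.
  move=> j; rewrite -val_eqE /= => jp.
  rewrite (AL _ j) //; last by have := ltn_ord j; lia.
  by rewrite Fseq_lt ?mulr0 ?mul0r //=; have := ltn_ord j; lia.
rewrite ALmax mul1r /cofactor addnn -signr_odd odd_double mul1r.
have minorE (a b : 'I_p) : row' ord_max (col' ord_max (A *m L)) a b =
    s * Fseq 1 r s p.+1 (p%:Z - 2 - a%:Z - b%:Z).
  by rewrite mxE [LHS]mxE (AL _ b) ?lift_max.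
(* The index [p - 2 - a - b] equals [-1] exactly on the antidiagonal, where [F] is 1, and is smaller
   beyond it. *)
apply: (@det_antitrig _ p s) => a b ab; rewrite minorE.
  by rewrite Fseq_lt ?mulr0 //; lia.
have -> : p%:Z - 2 - a%:Z - b%:Z = 0%N%:Z - 1 by lia.
by rewrite Fseq_init_le ?mulr1.
Qed.

Theorem corollary5p1 (k : nat) (r s : int) (n : nat) :
  (2 <= k)%N -> 1 <= r -> 1 <= s ->
  \det (Amat 1 r s k *m Qmat 1 r s k ^+ n.+1) =
  s ^+ (n + k) *
    (-1) ^+ (((k - 1) * (k + 6) + 2 * (k + 1) * (n + 1)) %/ 2)%N.
Proof.
case: k => [//|p] p1 _ _.
rewrite det_mulmx det_exp det_Amat1 det_Qmat1 // exprMn -exprM.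
rewrite mulrACA -!exprD mulrC; congr (s ^+ _ * _); first by lia.
have C2 := mul_bin_left p 1; rewrite bin1 in C2.
(* The stated exponent exceeds the computed one, ['C(p, 2) + p * n.+1], by an even number, so the
   signs agree. *)
have -> : ((p.+1 - 1) * (p.+1 + 6) + 2 * (p.+1 + 1) * (n + 1) =
           ('C(p, 2) + p * n.+1 + 2 * (2 * p + n.+1)) * 2)%N by nia.
by rewrite mulnK // [RHS]exprD [X in _ = _ * X]exprM sqrrN !expr1n mulr1.
Qed.
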